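(* Let $\mathbb{K}$ be a field of characteristic $0$. Let $G$ be a simple graph on $5$ vertices that contains a $5$-cycle $Z$ as a subgraph, and suppose that, for some monomial order $\prec$, the initial ideal $J=\mathrm{in}_\prec(I_G)$ of the Artinian Orlik-Terao ideal $I_G\subset S$ of $G$ is such that $S/J$ has the Weak Lefschetz Property. Let $G'$ be a graph obtained from $G$ by adding a chord of $Z$ (an edge joining two vertices non-adjacent in $Z$) that is not already an edge of $G$. Then the Artinian Orlik-Terao algebra of $G'$ over $\mathbb{K}$ has the Weak Lefschetz Property.
   Context: Artinian Orlik-Terao (AOT) algebra of a graph: let $G$ be a finite simple graph with vertices $1,\dots,n$ and edges $e_1,\dots,e_d$. Its graphic arrangement consists of the hyperplanes $H_t=V(\ell_t)$, where $\ell_t=x_i-x_j$ for the edge $e_t=(i,j)$, $i<j$. Let $S=\mathbb{K}[y_1,\dots,y_d]$. For each subset $\Lambda=\{i_1,\dots,i_k\}\subseteq\{1,\dots,d\}$ with $\mathrm{codim}(H_{i_1}\cap\dots\cap H_{i_k})<k$ and each nontrivial linear relation $\sum_{t\in\Lambda}c_t\ell_t=0$ with $c_t\in\mathbb{K}$, put $f_\Lambda=\sum_{j=1}^k c_{i_j}\,y_{i_1}\cdots\widehat{y_{i_j}}\cdots y_{i_k}$. The AOT ideal $I_G$ is the ideal of $S$ generated by all such $f_\Lambda$ together with $y_1^2,\dots,y_d^2$, and the AOT algebra of $G$ is $S/I_G$ (a standard graded Artinian algebra). Weak Lefschetz Property (WLP): a graded Artinian quotient $A=S/I$ has WLP if there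 is a linear form $\ell\in S_1$ such that for all $i$ the multiplication map $\mu_\ell:A_i\to A_{i+1}$, $a\mapsto \ell a$, has maximal rank, i.e. is injective or surjective. A graph is said to have WLP if its AOT algebra does. *)

(* Defs.v *)
From HB Require Import structures.
From mathcomp Require Import all_boot all_order all_algebra.
From mathcomp Require Export mpoly.

Set Implicit Arguments.
Unset Strict Implicit.
Unset Printing Implicit Defensive.

Import GRing.Theory.
Local Open Scope ring_scope.

Section Ideals.
Variables (d : nat) (R : comNzRingType).
Local Notation S := {mpoly R[d]}.

Definition ideal_gen (gens : S -> Prop) (p : S) : Prop :=
  exists s : seq (S * S),
    (forall x, x \in s -> gens x.2) /\ p = \sum_(x <- s) x.1 * x.2.

(* [le m1 m2] reads "m1 precedes or equals m2".  By Dickson's lemma such an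
   order is automatically a well-order. *)
Definition monomial_order (le : rel 'X_{1..d}) : Prop :=
  [/\ total le, antisymmetric le, transitive le,
      forall m, le 0%MM m
    & forall m1 m2 m, le m1 m2 -> le (m1 + m)%MM (m2 + m)%MM].

(* No [m] is a leading monomial of 0. *)
Definition is_lead (le : rel 'X_{1..d}) (p : S) (m : 'X_{1..d}) : Prop :=
  m \in msupp p /\ {in msupp p, forall m', le m' m}.

Definition initial_ideal (le : rel 'X_{1..d}) (I : S -> Prop) : S -> Prop :=
  ideal_gen (fun q => exists p m, [/\ I p, is_lead le p m & q = 'X_[m]]).

(* For a homogeneous ideal I, the graded piece (S/I)_i is the space of forms
   of degree i modulo the congruence a - b \in I; the two definitions below
   are injectivity and surjectivity of (S/I)_i -> (S/I)_(i+1), a |-> l * a,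
   on representatives.  They are only meant for homogeneous I. *)
Definition mul_injective (I : S -> Prop) (l : S) (i : nat) : Prop :=
  forall a b : S, a \is i.-homog -> b \is i.-homog ->
    I (l * a - l * b) -> I (a - b).

Definition mul_surjective (I : S -> Prop) (l : S) (i : nat) : Prop :=
  forall b : S, b \is i.+1.-homog ->
    exists2 a : S, a \is i.-homog & I (l * a - b).

Definition has_WLP (I : S -> Prop) : Prop :=
  exists2 l : S, l \is 1.-homog &
    forall i : nat, mul_injective I l i \/ mul_surjective I l i.

End Ideals.

Section Graphs.
Variable n : nat.

Definition simple_graph (e : rel 'I_n) : Prop :=
  ssrbool.symmetric e /\ irreflexive e.

Definition edges (e : rel 'I_n) : {set 'I_n * 'I_n} :=
  [set ij : 'I_n * 'I_n | (ij.1 < ij.2)%N && e ij.1 ij.2].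

Definition edge (e : rel 'I_n) (t : 'I_#|edges e|) : 'I_n * 'I_n := enum_val t.

Definition add_edge (e : rel 'I_n) (u v : 'I_n) : rel 'I_n :=
  fun x y => [|| e x y, (x == u) && (y == v) | (x == v) && (y == u)].

Definition is_chord (Z : seq 'I_n) (u v : 'I_n) : bool :=
  [&& u \in Z, v \in Z, u != v, next Z u != v & next Z v != u].

End Graphs.

Section OrlikTerao.
Variables (K : fieldType) (n : nat) (e : rel 'I_n).
Local Notation d := #|edges e|.

Definition coord_diff (ij : 'I_n * 'I_n) (x : 'rV[K]_n) : K^o :=
  x 0 ij.1 - x 0 ij.2.

Fact coord_diff_linear ij : linear (coord_diff ij).
Proof.
by move=> a x y; rewrite /coord_diff !mxE scalerBr addrACA opprD.
Qed.

HB.instance Definition _ ij :=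
  GRing.isLinear.Build K 'rV[K]_n K^o _ (coord_diff ij) (coord_diff_linear ij).

Definition edge_form (t : 'I_d) : 'Hom('rV[K]_n, K^o) :=
  linfun (coord_diff (edge t)).

Definition hyperplane (t : 'I_d) : {vspace 'rV[K]_n} := lker (edge_form t).

Definition codim (U : {vspace 'rV[K]_n}) : nat := (n - \dim U)%N.

Definition dependent (L : {set 'I_d}) : Prop :=
  (codim (\bigcap_(t in L) hyperplane t)%VS < #|L|)%N.

Definition nontrivial_relation (L : {set 'I_d}) (c : 'I_d -> K) : Prop :=
  (exists2 t, t \in L & c t != 0) /\ \sum_(t in L) c t *: edge_form t = 0.

Definition relation_poly (L : {set 'I_d}) (c : 'I_d -> K) : {mpoly K[d]} :=
  \sum_(j in L) c j *: \prod_(s in L :\ j) 'X_s.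

Definition AOT_ideal : {mpoly K[d]} -> Prop :=
  ideal_gen (fun q : {mpoly K[d]} =>
    (exists (L : {set 'I_d}) (c : 'I_d -> K),
       [/\ dependent L, nontrivial_relation L c & q = relation_poly L c])
    \/ (exists t : 'I_d, q = 'X_t ^+ 2)).

End OrlikTerao.

Arguments AOT_ideal K {n} e _.

Definition graph_has_WLP (K : fieldType) (n : nat) (e : rel 'I_n) : Prop :=
  has_WLP (AOT_ideal K e).

(* Main.v *)
(* Every simple graph on 5 vertices containing a 5-cycle has the WLP.  Labelling
   the 5-cycle 0-1-2-3-4-0 leaves 32 graphs, and one fixed integral linear form
   l works for all of them: multiplication by l is injective in degrees 0, 1, 2
   and surjective in degree 3, hence in all larger degrees.

   Surjectivity is Gaussian elimination on square-free monomials modulo the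
   relations of circuits.  Injectivity also needs a lower bound on S/I.  For a
   linear order on the vertices, sending the variable of an edge to +-z_v, where
   v is its later endpoint, defines a ring map from S to K[z]/(z_v^2) that kills
   the whole AOT ideal; its coefficients, for the various orders, supply enough
   linear functionals vanishing on I.  Both eliminations have integer entries
   and remain valid over any field of characteristic 0. *)
From HB Require Import structures.
Require Import Defs.
From Stdlib Require Import ZArith.
From mathcomp Require Import all_boot all_order all_algebra.
From mathcomp Require Import ssrZ ring zify.

Set Implicit Arguments.
Unset Strict Implicit.
Unset Printing Implicit Defensive.

Import GRing.Theory.
Local Open Scope ring_scope.

(** * Sparse Gaussian elimination over the integers *)

(* Sparse integer vectors with entries sorted by decreasing key; the sorting
   makes the elimination effective, but its soundness does not depend on it.
   Below, a key is the bit mask of a square-free monomial. *)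
Definition zrow := seq (N * Z).

Definition scale_row (a : Z) (r : zrow) : zrow :=
  [seq (x.1, Z.mul a x.2) | x <- r].

(** A merge of sorted rows in which cancelled entries are dropped, so that the head of a combination
    is again a usable pivot. *)
Fixpoint comb (a b : Z) (r : zrow) : zrow -> zrow :=
  if r isn't (k, x) :: r' then scale_row b else
  fix combr (s : zrow) : zrow :=
    if s isn't (h, y) :: s' then scale_row a r else
    match N.compare k h with
    | Gt => (k, Z.mul a x) :: comb a b r' s
    | Lt => (h, Z.mul b y) :: combr s'
    | Eq => let z := Z.add (Z.mul a x) (Z.mul b y) in
            if Z.eqb z 0 then comb a b r' s' else (k, z) :: comb a b r' s'
    end.

Definition add_row : zrow -> zrow -> zrow := comb 1 1.

Definition sort_row (r : zrow) : zrow := foldr (fun x => add_row [:: x]) [::] r.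

(** Dividing by the content keeps the integers small. The test that [g] times [r'] gives back [r]
    spares any reasoning about [Z.gcd] and [Z.div] in the soundness proof. *)
Definition primitive_part (r : zrow) : zrow :=
  let g := foldr (fun x => Z.gcd x.2) Z0 r in
  let r' := [seq (x.1, Z.div x.2 g) | x <- r] in
  if (scale_row g r' == r) && ~~ Z.eqb g 0 then r' else r.

Definition reduce_by (r p : zrow) : zrow :=
  match r, p with
  | (k, x) :: _, (h, y) :: _ =>
      if N.eqb k h then primitive_part (comb y (Z.opp x) r p) else r
  | _, _ => r
  end.

Fixpoint insert_row (r : zrow) (ps : seq zrow) : seq zrow :=
  match r, ps with
  | (k, _) :: _, ((h, y) :: p) :: ps' =>
     if N.ltb k h then ((h, y) :: p) :: insert_row r ps' else r :: ps
  | [::], _ => ps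
  | _, _ => r :: ps
  end.

(** The pivots are kept by decreasing head. Cancelling a head only exposes smaller keys, so a single
    pass through the pivots suffices. *)
Definition echelon (rows : seq zrow) : seq zrow :=
  foldl (fun ps r => insert_row (foldl reduce_by r ps) ps) [::] rows.

Definition solve_step (r : zrow) (known : seq N) : seq N :=
  if r is (k, c) :: r' then
    if ~~ Z.eqb c 0 && all (fun x => x.1 \in known) r' then k :: known else known
  else known.

(** Back substitution: [foldr] starts from the last row, whose head is smallest, and a head becomes
    known once all later keys of its row are. *)
Definition solve (known : seq N) (ps : seq zrow) : seq N :=
  foldr solve_step known ps.

Definition scalar_of_Z (K : pzRingType) (z : Z) : K := (int_of_Z z)%:~R.

HB.instance Definition _ (K : pzRingType) :=
  GRing.RMorphism.copy (@scalar_of_Z K) (intmul (1 : K) \o int_of_Z).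

Lemma scalar_of_ZD (K : pzRingType) (a b : Z) :
  scalar_of_Z K (Z.add a b) = scalar_of_Z K a + scalar_of_Z K b.
Proof. exact: rmorphD. Qed.

Lemma scalar_of_ZM (K : pzRingType) (a b : Z) :
  scalar_of_Z K (Z.mul a b) = scalar_of_Z K a * scalar_of_Z K b.
Proof. exact: rmorphM. Qed.

Lemma scalar_of_Z1 (K : pzRingType) : scalar_of_Z K Z.one = 1.
Proof. exact: rmorph1. Qed.

(** This is where characteristic 0 enters: nonzero integers are invertible in [K], so integer pivots
    remain pivots. *)
Lemma scalar_of_Z_eq0 (K : fieldType) (z : Z) :
  [pchar K] =i pred0 -> (scalar_of_Z K z == 0) = Z.eqb z 0.
Proof.
move=> hK; apply/eqP/Z.eqb_spec => [|->]; last exact: rmorph0.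
rewrite /scalar_of_Z => z0; apply: (can_inj int_of_ZK); move: z0.
case: (int_of_Z z) => m; last rewrite NegzE mulrNz => /eqP; last rewrite oppr_eq0.
  rewrite -pmulrn => /eqP; rewrite ((pcharf0P K).1 hK) => /eqP -> //.
by rewrite -pmulrn ((pcharf0P K).1 hK).
Qed.

Section RowValues.
Variables (K : fieldType) (M : lmodType K) (x : N -> M).
Local Notation "z %:K" := (scalar_of_Z K z) (at level 2, format "z %:K").

Definition row_value (r : zrow) : M := \sum_(t <- r) t.2%:K *: x t.1.

Lemma row_value_nil : row_value [::] = 0.
Proof. exact: big_nil. Qed.

Lemma row_value_cons t r : row_value (t :: r) = t.2%:K *: x t.1 + row_value r.
Proof. exact: big_cons. Qed.

Lemma row_value_cat r s : row_value (r ++ s) = row_value r + row_value s.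
Proof. exact: big_cat. Qed.

Lemma row_value_scale a r : row_value (scale_row a r) = a%:K *: row_value r.
Proof.
rewrite /row_value big_map scaler_sumr; apply: eq_bigr => t _.
by rewrite scalar_of_ZM scalerA.
Qed.

Lemma row_value_comb a b r s :
  row_value (comb a b r s) = a%:K *: row_value r + b%:K *: row_value s.
Proof.
elim: r s => [|[k c] r IHr] s; first by rewrite row_value_nil scaler0 add0r row_value_scale.
elim: s => [|[h y] s IHs]; first by rewrite row_value_nil scaler0 addr0 -row_value_scale.
rewrite /=; case: N.compare_spec => [<-|_|_].
- set z := Z.add (Z.mul a c) (Z.mul b y).
  have zE : z%:K = a%:K * c%:K + b%:K * y%:K.
    by rewrite scalar_of_ZD !scalar_of_ZM.
  have -> : row_value (if Z.eqb z 0 then comb a b r s else (k, z) :: comb a b r s) =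
            row_value ((k, z) :: comb a b r s).
    case: Z.eqb_spec => // z0.
    by rewrite row_value_cons z0 [Z0%:K]rmorph0 scale0r add0r.
  by rewrite !row_value_cons IHr /= zE !scalerDr !scalerA scalerDl addrACA.
- move: IHs; rewrite !row_value_cons /= => ->.
  by rewrite !scalerDr !scalerA scalar_of_ZM addrCA.
- by rewrite row_value_cons IHr !row_value_cons /= scalar_of_ZM !scalerDr !scalerA !addrA.
Qed.

Lemma row_value_add r s : row_value (add_row r s) = row_value r + row_value s.
Proof. by rewrite row_value_comb scalar_of_Z1 !scale1r. Qed.

Lemma row_value_sort r : row_value (sort_row r) = row_value r.
Proof.
elim: r => //= t r IH.
by rewrite row_value_add IH !row_value_cons row_value_nil addr0.
Qed.

End RowValues.

Definition subspace (K : pzRingType) (M : lmodType K) (V : M -> Prop) : Prop :=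
  [/\ V 0, forall u v, V u -> V v -> V (u + v) & forall a u, V u -> V (a *: u)].

Lemma subspace_sum (K : pzRingType) (M : lmodType K) (V : M -> Prop)
    (T : eqType) (r : seq T) (P : pred T) (F : T -> M) :
  subspace V -> (forall t, t \in r -> P t -> V (F t)) -> V (\sum_(t <- r | P t) F t).
Proof.
case=> V0 VD _ VF; rewrite big_seq_cond; apply: big_ind => // t /andP[tr Pt].
exact: VF.
Qed.

(** * Soundness of elimination relative to an arbitrary subspace *)

Section Elimination.
Variables (K : fieldType) (M : lmodType K) (x : N -> M) (V : M -> Prop).
Hypotheses (hK : [pchar K] =i pred0) (hV : subspace V).
Local Notation val := (row_value x).
Local Notation "z %:K" := (scalar_of_Z K z) (at level 2, format "z %:K").

Lemma primitive_part_in r : V (val r) -> V (val (primitive_part r)).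
Proof.
case: (hV) => _ _ VZ; rewrite /primitive_part.
set g := foldr _ _ _; set r' := map _ _; case: ifP => // /andP[/eqP <- g0].
rewrite row_value_scale => /(VZ g%:K^-1); rewrite scalerA mulVf ?scale1r //.
by rewrite scalar_of_Z_eq0.
Qed.

Lemma reduce_by_in r p : V (val r) -> V (val p) -> V (val (reduce_by r p)).
Proof.
case: (hV) => _ VD VZ.
case: r p => [|[k c] r] [|[h y] p] // Vr Vp; rewrite /reduce_by; case: ifP => // _.
by apply: primitive_part_in; rewrite row_value_comb; apply: VD; apply: VZ.
Qed.

Definition rows_in (rs : seq zrow) : Prop := {in rs, forall r, V (val r)}.

Lemma rows_in_cons r rs : rows_in (r :: rs) <-> V (val r) /\ rows_in rs.
Proof.
split=> [H|[Hr Hrs] s]; first by split=> [|s sr]; apply: H; rewrite inE ?eqxx ?sr ?orbT.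
by rewrite inE => /predU1P[->|/Hrs].
Qed.

Lemma rows_in_cat rs ss : rows_in rs -> rows_in ss -> rows_in (rs ++ ss).
Proof. by move=> Hr Hs r; rewrite mem_cat => /orP[/Hr|/Hs]. Qed.

Lemma rows_in_flatten (rss : seq (seq zrow)) :
  {in rss, forall rs, rows_in rs} -> rows_in (flatten rss).
Proof. by move=> H r /flattenP[rs /H rsV /rsV]. Qed.

Lemma rows_in_map (T : eqType) (s : seq T) (f : T -> zrow) :
  {in s, forall t, V (val (f t))} -> rows_in (map f s).
Proof. by move=> H r /mapP[t /H Vt ->]. Qed.

Lemma insert_row_in r ps : V (val r) -> rows_in ps -> rows_in (insert_row r ps).
Proof.
case: r => [|[k c] r] Vr; first by case: ps.
elim: ps => [|p ps IH] Hps; first exact/rows_in_cons.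
case: p Hps => [|[h y] p] Hps /=; first exact/rows_in_cons.
case: ifP => _; last exact/rows_in_cons.
by case/rows_in_cons: Hps => ? /IH ?; apply/rows_in_cons.
Qed.

Lemma echelon_in rows : rows_in rows -> rows_in (echelon rows).
Proof.
rewrite /echelon; have: rows_in [::] by [].
elim: rows [::] => [|r rows IH] ps Vps //= /rows_in_cons[Vr Vrows].
apply: IH => //; apply: insert_row_in => //.
elim: ps r Vr Vps => [|p ps IHp] r Vr //= /rows_in_cons[Vp Vps].
by apply: IHp => //; apply: reduce_by_in.
Qed.

(** If a row and its tail both have value in [V], so does the head term, and its coefficient is
    invertible. The lemma is applied with three choices of [V]: the image of multiplication by the
    linear form modulo the ideal, the span of a set of monomials modulo the ideal, and the zero
    subspace of the base field. *)
Lemma solve_in known ps :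
  {in known, forall k, V (x k)} -> rows_in ps -> {in solve known ps, forall k, V (x k)}.
Proof.
move=> Hk; elim: ps => [//|p ps IH] /rows_in_cons[Vp /IH {}IH] /=.
case: p Vp => [|[k c] p] //=; case: ifP => // /andP[c0 /allP pk] Vp j.
rewrite inE => /predU1P[->|/IH //]; case: (hV) => _ VD VZ.
have Vs : V (val p) by apply: subspace_sum => // t /pk /IH Vt _; apply: VZ.
have {Vs} := VD _ _ Vp (VZ (-1) _ Vs).
rewrite row_value_cons /= scaleN1r addrK => /(VZ c%:K^-1).
by rewrite scalerA mulVf ?scale1r // scalar_of_Z_eq0.
Qed.

End Elimination.

(** * Square-free monomials modulo an ideal *)

Definition ideal (R : pzRingType) (I : R -> Prop) : Prop :=
  [/\ I 0, forall p q, I p -> I q -> I (p + q) & forall a p, I p -> I (a * p)].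

Definition eqmod (R : pzRingType) (I : R -> Prop) (p q : R) : Prop := I (p - q).

Lemma ideal_gen_ideal (d : nat) (R : comNzRingType) (gens : {mpoly R[d]} -> Prop) :
  ideal (ideal_gen gens).
Proof.
split=> [|p q [s [sg ->]] [t [tg ->]]|a p [s [sg ->]]].
- by exists [::]; rewrite big_nil.
- exists (s ++ t); split; last by rewrite big_cat.
  by move=> x; rewrite mem_cat => /orP[/sg|/tg].
- exists [seq (a * x.1, x.2) | x <- s]; split; first by move=> _ /mapP[x /sg gx ->].
  by rewrite big_map mulr_sumr; apply: eq_bigr => x _; rewrite mulrA.
Qed.

Lemma mem_ideal_gen (d : nat) (R : comNzRingType) (gens : {mpoly R[d]} -> Prop) p :
  gens p -> ideal_gen gens p.
Proof.
move=> gp; exists [:: (1, p)]; rewrite big_seq1 mul1r; split=> //.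
by move=> x; rewrite inE => /eqP ->.
Qed.

Section IdealCongruence.
Variables (d : nat) (K : fieldType) (I : {mpoly K[d]} -> Prop).
Hypothesis hI : ideal I.
Implicit Types (p q r s : {mpoly K[d]}).

Lemma idealZ a p : I p -> I (a *: p).
Proof. by case: hI => _ _ IM Ip; rewrite -mul_mpolyC; apply: IM. Qed.

Lemma ideal_subspace : subspace I.
Proof. by case: (hI) => I0 ID _; split=> // a p; apply: idealZ. Qed.

Lemma eqmod_refl p : eqmod I p p.
Proof. by rewrite /eqmod subrr; case: hI. Qed.

Lemma eqmod_sym p q : eqmod I p q -> eqmod I q p.
Proof. by move/(idealZ (-1)); rewrite scaleN1r opprB. Qed.

Lemma eqmod_trans q p r : eqmod I p q -> eqmod I q r -> eqmod I p r.
Proof. by case: (hI) => _ ID _ pq /(ID _ _ pq); rewrite addrA subrK. Qed.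

Lemma eqmodD p q r s : eqmod I p q -> eqmod I r s -> eqmod I (p + r) (q + s).
Proof. by case: (hI) => _ ID _ pq /(ID _ _ pq); rewrite /eqmod opprD addrACA. Qed.

Lemma eqmodMl a p q : eqmod I p q -> eqmod I (a * p) (a * q).
Proof. by case: (hI) => _ _ IM /(IM a); rewrite mulrBr. Qed.

Lemma eqmodZ a p q : eqmod I p q -> eqmod I (a *: p) (a *: q).
Proof. by move/(idealZ a); rewrite scalerBr. Qed.

Lemma eqmod_in p q : eqmod I p q -> I q -> I p.
Proof. by case: (hI) => _ ID _ pq /(ID _ _ pq); rewrite subrK. Qed.

Lemma eqmod0 p : I p -> eqmod I 0 p.
Proof. by move=> Ip; apply: eqmod_sym; rewrite /eqmod subr0. Qed.

Lemma eqmod_sum (T : eqType) (r : seq T) (F G : T -> {mpoly K[d]}) :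
  {in r, forall t, eqmod I (F t) (G t)} ->
  eqmod I (\sum_(t <- r) F t) (\sum_(t <- r) G t).
Proof.
move=> FG; rewrite /eqmod -sumrB.
by apply: subspace_sum => [|t tr _]; [exact: ideal_subspace | exact: FG].
Qed.

End IdealCongruence.

(** Filtering on a free bit gives every mask exactly [k] bits, even if [g] has repetitions. *)
Fixpoint masks (g : seq nat) (k : nat) : seq N :=
  match k, g with
  | 0, _ => [:: N0]
  | _, [::] => [::]
  | k'.+1, i :: g' => masks g' k ++
     [seq N.setbit m (N.of_nat i) | m <- masks g' k' & ~~ N.testbit m (N.of_nat i)]
  end.

(** Multiplication by s times the variable i; terms already containing that variable are dropped, as
    its square lies in the ideal. *)
Definition mul_row (i : nat) (s : Z) (r : zrow) : zrow :=
  [seq (N.setbit x.1 (N.of_nat i), Z.mul s x.2)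
  | x <- r & ~~ N.testbit x.1 (N.of_nat i)].

(* In terms of p = \prod_j x_j this computes (p, \sum_j p / x_j). *)
Definition prod_deriv (R : pzRingType) (xs : seq R) : R * R :=
  foldr (fun x PD => (x * PD.1, x * PD.2 + PD.1)) (1, 0) xs.

(** The recursion of [prod_deriv] carried out on rows, started from the monomial of [m] instead of
    1: it yields monomial multiples of circuit relations, reduced modulo squares. *)
Definition deriv_row (es : seq (nat * Z)) (m : N) : zrow * zrow :=
  foldr (fun e PD => (mul_row e.1 e.2 PD.1, add_row (mul_row e.1 e.2 PD.2) PD.1))
   ([:: (m, Z.one)], [::]) es.

Section SquareZero.
Variables (d : nat) (K : fieldType) (I : {mpoly K[d]} -> Prop).
Variables (b : nat) (y : nat -> {mpoly K[d]}).
Hypotheses (hI : ideal I) (hy : forall i, I (y i ^+ 2)).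
Local Notation "z %:K" := (scalar_of_Z K z) (at level 2, format "z %:K").

Definition mask_prod (m : N) : {mpoly K[d]} :=
  \prod_(i < b | N.testbit m (N.of_nat i)) y i.

Local Notation val := (row_value mask_prod).

Lemma mask_prod0 : mask_prod N0 = 1.
Proof. by apply: big_pred0 => i. Qed.

Lemma testbit_setbit m i j :
  N.testbit (N.setbit m (N.of_nat i)) (N.of_nat j) = (i == j) || N.testbit m (N.of_nat j).
Proof.
rewrite N.setbit_eqb; congr (_ || _).
by apply/N.eqb_spec/eqP => [/Nnat.Nat2N.inj|->].
Qed.

Lemma mask_prod_setbit m i : (i < b)%N -> ~~ N.testbit m (N.of_nat i) ->
  mask_prod (N.setbit m (N.of_nat i)) = y i * mask_prod m.
Proof.
move=> ib mi; rewrite /mask_prod (bigD1 (Ordinal ib)) /=; last first.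
  by rewrite testbit_setbit eqxx.
congr (_ * _); apply: eq_bigl => j; rewrite testbit_setbit -val_eqE /=.
by rewrite [X in _ && ~~ X]eq_sym; have [<-|] := eqVneq i; rewrite ?(negbTE mi) //= andbT.
Qed.

Lemma mask_prod_testbit m i : (i < b)%N -> N.testbit m (N.of_nat i) ->
  I (y i * mask_prod m).
Proof.
move=> ib mi; rewrite /mask_prod (bigD1 (Ordinal ib)) //= mulrA -expr2 mulrC.
by case: hI => _ _; apply.
Qed.

Lemma row_value_mul i s r : (i < b)%N ->
  eqmod I (val (mul_row i s r)) (s%:K *: y i * val r).
Proof.
move=> ib; rewrite /row_value big_map big_filter mulr_sumr big_mkcond /=.
apply: eqmod_sum => // -[m c] _ /=; rewrite scalar_of_ZM -scalerAl -scalerAr scalerA.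
case: ifP => /= mi; first by rewrite mask_prod_setbit //; apply: eqmod_refl.
by apply: eqmod0 => //; apply: idealZ => //; apply: mask_prod_testbit => //; move/negbFE: mi.
Qed.

Lemma row_value_deriv es m : all (fun e => e.1 < b)%N es ->
  let D := prod_deriv [seq e.2%:K *: y e.1 | e <- es] in
  eqmod I (val (deriv_row es m).1) (D.1 * mask_prod m) /\
  eqmod I (val (deriv_row es m).2) (D.2 * mask_prod m).
Proof.
elim: es => [_|e es IH /= /andP[eb /IH{IH}[IH1 IH2]]].
  rewrite /= row_value_cons row_value_nil /= scalar_of_Z1 scale1r addr0 mul1r mul0r.
  by split; apply: eqmod_refl.
split; first by apply: eqmod_trans (row_value_mul _ _ eb) _; rewrite -?mulrA //; apply: eqmodMl.
rewrite row_value_add mulrDl; apply: eqmodD => //.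
by apply: eqmod_trans (row_value_mul _ _ eb) _; rewrite -?mulrA //; apply: eqmodMl.
Qed.

Lemma mask_prod_homog g k m : all (fun i => i < b)%N g ->
  (forall i, y i \is 1.-homog) -> m \in masks g k -> mask_prod m \is k.-homog.
Proof.
move=> gb y1; elim: g k m gb => [|i g IH] [|k] m //=.
- by rewrite inE => _ /eqP ->; rewrite mask_prod0 dhomog1.
- by rewrite inE => _ /eqP ->; rewrite mask_prod0 dhomog1.
move=> /andP[ib gb]; rewrite mem_cat => /orP[/IH|/mapP[m']]; first exact.
rewrite mem_filter => /andP[m'i m'g] ->; rewrite mask_prod_setbit // -add1n.
by apply: dhomogM => //; apply: IH.
Qed.

End SquareZero.

(** * The Artinian Orlik-Terao ideal of a graph *)

Definition flip_if (T : Type) (b : bool) (p : T * T) : T * T :=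
  if b then (p.2, p.1) else p.

Section OrlikTerao.
Variables (K : fieldType) (n : nat) (e : rel 'I_n).
Hypothesis he : simple_graph e.
Local Notation d := #|edges e|.
Local Notation I := (AOT_ideal K e).

Lemma AOT_ideal_ideal : ideal I.
Proof. exact: ideal_gen_ideal. Qed.

Lemma edge_lt (t : 'I_d) : ((edge t).1 < (edge t).2)%N.
Proof. by have := enum_valP t; rewrite inE => /andP[]. Qed.

Lemma edge_rel (t : 'I_d) : e (edge t).1 (edge t).2.
Proof. by have := enum_valP t; rewrite inE => /andP[]. Qed.

Lemma edge_inj : injective (@edge n e).
Proof. exact: enum_val_inj. Qed.

Lemma edge_neq_flip (t s : 'I_d) : edge t != flip_if true (edge s).
Proof.
apply/eqP => E; have := edge_lt t; rewrite E /= => /ltn_trans/(_ (edge_lt s)).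
by rewrite ltnn.
Qed.

Lemma edge_exists (p : 'I_n * 'I_n) : e p.1 p.2 -> exists (t : 'I_d) b, p = flip_if b (edge t).
Proof.
case: he => esym eirr; case: p => u v /= euv.
have [uv|vu|/val_inj uv] := ltngtP u v; last by rewrite uv eirr in euv.
- have uvE : (u, v) \in edges e by rewrite inE uv.
  exists (enum_rank_in uvE (u, v)), false; by rewrite /= /edge enum_rankK_in.
- have vuE : (v, u) \in edges e by rewrite inE vu esym.
  exists (enum_rank_in vuE (v, u)), true; by rewrite /= /edge enum_rankK_in.
Qed.

(* The variable of an oriented edge; reversing the orientation negates it, and
   it is 0 on non-edges. *)
Definition edge_var (p : 'I_n * 'I_n) : {mpoly K[d]} :=
  \sum_(t : 'I_d | edge t == p) 'X_t - \sum_(t : 'I_d | edge t == flip_if true p) 'X_t.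

Lemma edge_var_flip b p : edge_var (flip_if b p) = (-1) ^+ b *: edge_var p.
Proof.
case: b; last by rewrite scale1r.
by rewrite scaleN1r /edge_var opprB; case: p.
Qed.

Lemma edge_var_edge (t : 'I_d) : edge_var (edge t) = 'X_t :> {mpoly K[d]}.
Proof.
rewrite /edge_var (big_pred1 t) => [|s]; last by rewrite (inj_eq edge_inj).
by rewrite big_pred0 ?subr0 // => s; apply/negbTE/edge_neq_flip.
Qed.

Lemma edge_var_nonedge p : ~~ e p.1 p.2 -> edge_var p = 0.
Proof.
case: he => esym _ np; rewrite /edge_var !big_pred0 ?subrr // => t; apply: contraNF np => /eqP.
  by case: p => u v E; have := edge_rel t; rewrite E /= esym.
by move=> <-; apply: edge_rel.
Qed.

Lemma edge_var_homog p : edge_var p \is 1.-homog.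
Proof.
have [/edge_exists[t [b ->]]|/edge_var_nonedge ->] := boolP (e p.1 p.2); last exact: dhomog0.
by rewrite edge_var_flip edge_var_edge; apply: dhomogZ; rewrite dhomogX /= mdeg1.
Qed.

Lemma edge_var_sqr p : I (edge_var p ^+ 2).
Proof.
have [/edge_exists[t [b ->]]|/edge_var_nonedge ->] := boolP (e p.1 p.2); last first.
  by rewrite expr0n; case: AOT_ideal_ideal.
rewrite edge_var_flip edge_var_edge exprZn; apply: idealZ; first exact: AOT_ideal_ideal.
by apply: mem_ideal_gen; right; exists t.
Qed.

(** By rank-nullity, each new hyperplane lowers the dimension by at most one, since a form has image
    of dimension at most one. *)
Lemma dim_cap_hyperplanes (r : seq 'I_d) :
  (n <= size r + \dim (\bigcap_(t <- r) hyperplane K t)%VS)%N.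
Proof.
elim: r => [|t r IH]; first by rewrite big_nil dimvf /= /dim /= mul1n.
rewrite big_cons /= capvC; set U := (\bigcap_(j <- r) _)%VS in IH *.
apply: leq_trans IH _; rewrite -(limg_ker_dim (edge_form K t) U) addSnnS leq_add2l addnC.
rewrite -[X in (_ <= X)%N]add1n; apply: leq_add => //.
by apply: leq_trans (dimvS (subvf _)) _; rewrite dimvf /dim /=.
Qed.

(** A form with nonzero coefficient vanishes wherever the other forms do. Its hyperplane can be left
    out of the intersection, which is thus cut out by #|L| - 1 hyperplanes. *)
Lemma nontrivial_relation_dependent (L : {set 'I_d}) (c : 'I_d -> K) :
  nontrivial_relation L c -> dependent K L.
Proof.
case=> -[t tL ct] rel; rewrite /dependent /codim.
have sub : (\bigcap_(s in L :\ t) hyperplane K s <= \bigcap_(s in L) hyperplane K s)%VS.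
  apply/subvP => x; rewrite !memvE => /subv_bigcapP xL; apply/subv_bigcapP => s sL.
  have [->{s sL}|st] := eqVneq s t; last by apply: xL; rewrite !inE st.
  have xker s : s \in L :\ t -> edge_form K s x = 0.
    by move/xL; rewrite -memvE memv_ker => /eqP.
  have := congr1 (fun f : 'Hom(_, _) => f x) rel.
  rewrite zero_lfunE sum_lfunE (bigD1 t) //= big1 => [|s /andP[sL st]].
    rewrite addr0 scale_lfunE => /eqP; rewrite scaler_eq0 (negbTE ct) /= => tx.
    by rewrite -memvE memv_ker.
  by rewrite scale_lfunE xker ?scaler0 // !inE st.
have := dim_cap_hyperplanes (enum (L :\ t)).
rewrite big_enum -cardE /= => /leq_trans; move/(_ _ _).
move/(_ (#|L :\ t| + \dim (\bigcap_(s in L) hyperplane K s)%VS)%N).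
rewrite leq_add2l dimvS // => /(_ isT) nL.
by rewrite [in X in (_ < X)%N](cardsD1 t) tL ltnS leq_subLR addnC.
Qed.
End OrlikTerao.

(** Each sign is its own inverse, so omitting the factor j from a product of signed variables
    multiplies the total sign by [c j]. Up to the unit [k], the sum is therefore the relation
    polynomial with coefficients [c]. *)
Lemma deriv_scaled_vars (R : comNzRingType) (d : nat) (c : 'I_d -> R) (us : seq 'I_d) :
  uniq us -> (forall t, c t * c t = 1) ->
  let k := \prod_(t <- us) c t in
  prod_deriv [seq c t *: ('X_t : {mpoly R[d]}) | t <- us] =
  (k *: \prod_(t <- us) 'X_t,
   k *: \sum_(j <- us) c j *: \prod_(s <- us | s != j) 'X_s).
Proof.
move=> + cc; elim: us => [_|t us IH] /=; first by rewrite !big_nil scale1r scaler0.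
case/andP=> tus /IH -> /=; rewrite !big_cons; congr pair.
  by rewrite -scalerAl -scalerAr scalerA.
rewrite eqxx /= scalerDr scalerA mulrAC cc mul1r addrC; congr (_ + _).
  congr (_ *: _); rewrite [RHS]big_seq_cond [LHS]big_seq; apply: eq_bigl => s.
  by case: (boolP (s \in us)) => // sus; apply/esym/eqP => st; rewrite -st sus in tus.
rewrite -scalerAl -scalerAr scalerA; congr (_ *: _).
rewrite mulr_sumr big_seq [RHS]big_seq; apply: eq_bigr => j jus.
by rewrite big_cons ifT ?scalerAr //; apply: contraNneq tus => ->.
Qed.

(** * Circuit relations in the AOT ideal *)

Section Circuits.
Variables (K : fieldType) (n : nat) (e : rel 'I_n).
Hypothesis he : simple_graph e.
Local Notation d := #|edges e|.
Local Notation I := (AOT_ideal K e).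

Lemma edge_formE (t : 'I_d) (x : 'rV[K]_n) :
  edge_form K t x = x 0 (edge t).1 - x 0 (edge t).2.
Proof. by rewrite lfunE. Qed.

Definition ordered_pair (p : 'I_n * 'I_n) : 'I_n * 'I_n := flip_if (p.2 < p.1)%N p.

(** When tails and heads agree as multisets, the forms of the oriented edges sum to 0. This is a
    linear relation with coefficients 1 and -1, recording the orientations. *)
Lemma circuit_deriv (ps : seq ('I_n * 'I_n)) :
  ps != [::] -> all (fun p => e p.1 p.2) ps -> uniq (map ordered_pair ps) ->
  perm_eq (unzip1 ps) (unzip2 ps) ->
  I (prod_deriv [seq edge_var K e p | p <- ps]).2.
Proof.
move=> ps0 pse psu psp.
have [ts psE] : exists ts : seq ('I_d * bool), ps = [seq flip_if tb.2 (edge tb.1) | tb <- ts].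
  elim: ps pse {ps0 psu psp} => [|p ps IH] /=; first by exists [::].
  case/andP=> /(edge_exists he)[t [b ->]] /IH[ts ->].
  by exists ((t, b) :: ts).
have usu : uniq (unzip1 ts).
  rewrite -(map_inj_uniq (@edge_inj n e)) -map_comp; move: psu.
  rewrite psE -map_comp; apply: etrans; congr uniq; apply: eq_map => -[t b] /=.
  rewrite /ordered_pair; have := edge_lt t; case: (edge t) b => u v [] /= uv; rewrite ?uv //.
  by rewrite ltnNge ltnW.
(* The orientation signs form a function of the edge because no edge occurs twice; the value 1
   elsewhere keeps [c t * c t = 1] for all [t]. *)
have [c cE cc] : exists2 c : 'I_d -> K,
    {in ts, forall tb : 'I_d * bool, c tb.1 = (-1) ^+ tb.2} & forall t, c t * c t = 1.
  elim: (ts) usu => [|[t b] ts' IH] /=; first by exists (fun=> 1) => // t; rewrite mulr1.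
  case/andP=> tts /IH[c cE cc].
  exists (fun s => if s == t then (-1) ^+ b else c s) => [s|s]; last first.
    by case: eqP => // _; rewrite -expr2 sqrr_sign.
  rewrite inE => /predU1P[->|sts] /=; first by rewrite eqxx.
  case: eqP => [st|_]; last exact: cE.
  by rewrite -st map_f in tts.
set us := unzip1 ts in usu.
have -> : [seq edge_var K e p | p <- ps] = [seq c t *: 'X_t | t <- us].
  rewrite psE -!map_comp; apply/eq_in_map => -[t b] tb /=.
  by rewrite edge_var_flip edge_var_edge (cE _ tb).
rewrite deriv_scaled_vars //=; apply: idealZ; first exact: AOT_ideal_ideal.
pose L := [set t in us]; have memL t : (t \in L) = (t \in us) by rewrite inE.
have sumL (V : nmodType) (F : 'I_d -> V) : \sum_(t in L) F t = \sum_(t <- us) F t.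
  by rewrite (eq_bigl _ _ memL) big_uniq.
have rel : nontrivial_relation L c.
  split.
    move: ps0; rewrite psE; case tsE: ts => [//|[t b] ts'] _.
    exists t; first by rewrite memL /us tsE inE eqxx.
    by apply: contraTneq (oner_neq0 K) => ct; rewrite -(cc t) ct mulr0 eqxx.
  apply/lfunP => x; rewrite sum_lfunE zero_lfunE sumL.
  transitivity (\sum_(p <- ps) (x 0 p.1 - x 0 p.2)).
    rewrite psE !big_map; apply: eq_big_seq => -[t b] tb /=.
    rewrite scale_lfunE edge_formE (cE _ tb).
    by case: b {tb}; rewrite /= ?scale1r // scaleN1r opprB.
  by rewrite sumrB -(big_map fst xpredT (x 0)) (perm_big _ psp) big_map subrr.
apply: mem_ideal_gen; left; exists L, c; split=> //.
  exact: nontrivial_relation_dependent rel.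
rewrite /relation_poly sumL big_seq [RHS]big_seq; apply: eq_bigr => j jus; congr (_ *: _).
rewrite [RHS](eq_bigl (fun s => (s \in us) && (s != j))) => [|s]; last by rewrite !inE andbC.
by rewrite big_mkcondr -big_uniq //= -big_mkcond.
Qed.

End Circuits.

(** * Residue maps attached to orders of the vertices *)

Section Residues.
Variables (K : fieldType) (n : nat) (e : rel 'I_n) (pos : 'I_n -> nat).
Hypotheses (he : simple_graph e) (pos_inj : injective pos).
Local Notation d := #|edges e|.
Local Notation I := (AOT_ideal K e).

Definition later (p : 'I_n * 'I_n) : 'I_n := if (pos p.2 < pos p.1)%N then p.1 else p.2.

Definition later_sign (p : 'I_n * 'I_n) : K := if (pos p.2 < pos p.1)%N then 1 else -1.

(** This is the leading term of the form of [p] when later vertices count as larger: [later_sign p]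
    is the coefficient of the later endpoint. *)
Definition residue (p : 'I_n * 'I_n) : {mpoly K[n]} := later_sign p *: 'X_(later p).

Definition square_ideal : {mpoly K[n]} -> Prop :=
  ideal_gen (fun q => exists v, q = 'X_v ^+ 2).

Lemma square_ideal_ideal : ideal square_ideal.
Proof. exact: ideal_gen_ideal. Qed.

Definition residue_map (p : {mpoly K[d]}) : {mpoly K[n]} :=
  p \mPo [tuple residue (edge t) | t < d].

HB.instance Definition _ := GRing.LRMorphism.copy residue_map
  (comp_mpoly [tuple residue (edge t) | t < d]).

Lemma residue_map_var (t : 'I_d) : residue_map 'X_t = residue (edge t).
Proof. by rewrite /residue_map comp_mpolyXU -tnth_nth tnth_mktuple. Qed.

Lemma residue_flip b p : p.1 != p.2 -> residue (flip_if b p) = (-1) ^+ b *: residue p.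
Proof.
case: p => u v /= uv; case: b; last by rewrite scale1r.
rewrite /residue /later /later_sign /=.
case: ltngtP => [||/pos_inj uvE]; rewrite ?scaleN1r ?scale1r ?opprK //.
by rewrite uvE eqxx in uv.
Qed.

Lemma later_sign_sqr p : later_sign p * later_sign p = 1.
Proof. by rewrite /later_sign; case: ifP; rewrite ?mulr1 // mulrNN mulr1. Qed.

(** An edge form involves no vertex beyond its later endpoint. *)
Lemma later_sign_delta (t : 'I_d) v : (pos (later (edge t)) <= pos v)%N ->
  ((edge t).1 == v)%:R - ((edge t).2 == v)%:R =
  if later (edge t) == v then later_sign (edge t) else 0.
Proof.
have := edge_lt t; case: (edge t) => a b /=; rewrite /later /later_sign /=.
case: (ltngtP (pos b) (pos a)) => [ba|ab|/pos_inj ->]; last by rewrite ltnn.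
- move=> _ av; have [E|_] := eqVneq b v; first by rewrite -E leqNgt ba in av.
  by case: eqP; rewrite ?subr0.
- move=> _ bv; have [E|_] := eqVneq a v; first by rewrite -E leqNgt ab in bv.
  by case: eqP; rewrite ?sub0r ?oppr0.
Qed.

Section Relation.
Variables (L : {set 'I_d}) (c : 'I_d -> K).
Hypothesis rel : \sum_(t in L) c t *: edge_form K t = 0.

Lemma relation_coord v :
  \sum_(t in L) c t * (((edge t).1 == v)%:R - ((edge t).2 == v)%:R) = 0.
Proof.
have := congr1 (fun f : 'Hom(_, _) => f (delta_mx 0 v)) rel.
rewrite sum_lfunE zero_lfunE; apply: etrans; apply: eq_bigr => t _.
by rewrite scale_lfunE edge_formE !mxE eqxx.
Qed.

(** In the coefficient of x_v, edges ending before v contribute nothing and those ending after v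
    have coefficient 0 by assumption. *)
Lemma relation_later v :
  (forall t, t \in L -> (pos v < pos (later (edge t)))%N -> c t = 0) ->
  \sum_(t in L | later (edge t) == v) c t * later_sign (edge t) = 0.
Proof.
move=> cv; rewrite -[RHS](relation_coord v) big_mkcondr; apply: eq_bigr => t tL.
have [/(cv t tL) ->|tv] := ltnP (pos v) (pos (later (edge t))).
  by rewrite !mul0r if_same.
by rewrite later_sign_delta //; case: eqP; rewrite ?mulr0.
Qed.

(** Descending induction on the later endpoint: once the edges ending further on have coefficient 0,
    the coefficient of x_v involves a single edge. *)
Lemma relation_zero m :
  {in L &, forall s t, later (edge s) = later (edge t) ->
     (m <= pos (later (edge t)))%N -> s = t} ->
  forall t, t \in L -> (m <= pos (later (edge t)))%N -> c t = 0.
Proof.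
move=> inj.
(* A bound on positions turns the descending induction into an ascending one on b minus the
   position. *)
have [b bP] : exists b, forall v, (pos v <= b)%N.
  by exists (\max_v pos v) => v; apply: leq_bigmax.
suff H j t : t \in L -> (m <= pos (later (edge t)))%N ->
    (b - pos (later (edge t)) < j)%N -> c t = 0 by move=> t tL mt; apply: H tL mt (ltnSn _).
elim: j t => // j IH t tL mt tj.
have := @relation_later (later (edge t)).
rewrite (bigD1 t) ?tL ?eqxx //= big1 => [|s /andP[/andP[sL /eqP st]]]; last first.
  by rewrite (inj s t) ?eqxx.
rewrite addr0 => H.
have: c t * later_sign (edge t) = 0.
  apply: H => s sL st; apply: IH => //; first by apply: leq_trans mt (ltnW st).
  by have := bP (later (edge s)); lia.
by move/(congr1 ( *%R^~ (later_sign (edge t)))); rewrite mul0r -mulrA later_sign_sqr mulr1.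
Qed.

(** A product containing two edges with the same later endpoint contains a square. If no endpoint is
    shared, all coefficients vanish by [relation_zero]. Otherwise let a and b share the last shared
    endpoint v: every term but the two omitting a or b contains a square, and these two either
    contain a square from a third edge at v or cancel by the coefficient of x_v in the relation. *)
Lemma residue_map_relation_poly : square_ideal (residue_map (relation_poly L c)).
Proof.
have [Q0 QD QM] := square_ideal_ideal.
have QZ a p : square_ideal p -> square_ideal (a *: p).
  by apply: idealZ; apply: square_ideal_ideal.
pose z t : {mpoly K[n]} := 'X_(later (edge t)).
have -> : residue_map (relation_poly L c) =
  \sum_(j in L) c j *: \prod_(s in L :\ j) residue (edge s).
  rewrite linear_sum; apply: eq_bigr => j _; rewrite linearZ rmorph_prod.
  by congr (_ *: _); apply: eq_bigr => s _; apply: residue_map_var.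
have Qprod (A : {set 'I_d}) s t : s \in A -> t \in A -> s != t ->
    later (edge s) = later (edge t) -> square_ideal (\prod_(r in A) residue (edge r)).
  move=> sA tA st E; rewrite (bigD1 s) //= (bigD1 t) /=; last by rewrite tA eq_sym.
  rewrite mulrA /residue E -scalerAl -scalerAr -scalerAl -scalerAl -expr2.
  rewrite mulrC scalerA; apply: (QZ); apply: (QM); apply: mem_ideal_gen.
  by eexists.
pose doubled t := (t \in L) && [exists s in L, (s != t) && (later (edge s) == later (edge t))].
have [a0 a0d|nod] := pickP doubled; last first.
  have c0 t : t \in L -> c t = 0.
    move=> tL; apply: (@relation_zero 0%N) => // s r sL rL sr _; apply/eqP.
    apply: contraFT (nod r) => nsr; rewrite /doubled rL; apply/existsP; exists s.
    by rewrite sL nsr sr eqxx.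
  by rewrite big1 // => j /c0 ->; rewrite scale0r.
(* Maximality makes the later endpoints beyond that of [a] pairwise distinct, as [relation_zero]
   requires. *)
case: (arg_maxnP (fun t => pos (later (edge t))) a0d) => a /andP[aL].
case/existsP=> b /and3P[bL ba /eqP ab] amax.
rewrite (bigD1 a) //= [X in _ + X](bigD1 b) /=; last by rewrite bL ba.
rewrite addrA; apply: (QD); last first.
  apply: (subspace_sum (ideal_subspace square_ideal_ideal)) => j _ /andP[/andP[jL ja] jb].
  by apply/QZ/(Qprod _ a b); rewrite ?inE ?aL ?bL ?andbT // eq_sym.
pose P := \prod_(s in L :\ a :\ b) residue (edge s).
have -> : \prod_(s in L :\ a) residue (edge s) = residue (edge b) * P.
  by rewrite (big_setD1 b) // !inE ba bL.
have -> : \prod_(s in L :\ b) residue (edge s) = residue (edge a) * P.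
  by rewrite (big_setD1 a) ?inE 1?eq_sym ?ba ?aL //= /P !setDDl setUC.
(* A third edge with this endpoint produces a square together with whichever of [a] and [b]
   remains. *)
have [/exists_inP[s]|] := boolP [exists s in L :\ a :\ b, later (edge s) == later (edge a)].
  rewrite !inE => /and3P[sb sa sL] /eqP sE.
  have Qs t : (t == a) || (t == b) -> square_ideal (residue (edge t) * P).
    move=> tab; have tP : t \notin L :\ a :\ b by rewrite !inE; case/orP: tab => ->; rewrite ?andbF.
    have -> : residue (edge t) * P = \prod_(r in t |: (L :\ a :\ b)) residue (edge r).
      by rewrite big_setU1.
    apply: (Qprod _ s t); rewrite ?inE ?eqxx ?sb ?sa ?sL ?orbT //.
      by case/orP: tab => /eqP ->.
    by case/orP: tab => /eqP ->; rewrite ?ab.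
  by apply: (QD); apply/QZ/Qs; rewrite eqxx ?orbT.
rewrite negb_exists_in => /forall_inP nos.
have sum0 : c a * later_sign (edge a) + c b * later_sign (edge b) = 0.
  rewrite -[RHS](@relation_later (later (edge a))).
    rewrite (bigD1 a) ?aL ?eqxx //= (bigD1 b) /=; last by rewrite bL ab eqxx ba.
    rewrite big1 ?addr0 // => s /andP[/andP[/andP[sL sE] sa] sb].
    by have := nos s; rewrite !inE sa sb sL sE => /(_ isT).
  apply: (@relation_zero (pos (later (edge a))).+1) => s t sL tL st at_; apply/eqP.
  apply: contraLR at_ => nst; rewrite -leqNgt; apply: amax.
  by rewrite /doubled tL; apply/existsP; exists s; rewrite sL nst st eqxx.
suff -> : c a *: (residue (edge b) * P) + c b *: (residue (edge a) * P) = 0 by [].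
rewrite /residue ab -!scalerAl !scalerA -scalerDl.
(* Since the signs square to 1, the combined coefficient of the two terms is a multiple of
   [sum0]. *)
have -> : c a * later_sign (edge b) + c b * later_sign (edge a) =
   later_sign (edge a) * later_sign (edge b) *
   (c a * later_sign (edge a) + c b * later_sign (edge b)).
  have -> : forall u v p q : K, u * v * (p * u + q * v) = p * v * (u * u) + q * u * (v * v).
    by move=> u v p q; ring.
  by rewrite !later_sign_sqr !mulr1.
by rewrite sum0 mulr0 scale0r.
Qed.
End Relation.

Lemma residue_map_ideal p : I p -> square_ideal (residue_map p).
Proof.
have [_ _ QM] := square_ideal_ideal.
case=> s [sg ->]; rewrite rmorph_sum.
apply: (subspace_sum (ideal_subspace square_ideal_ideal)) => x /sg gx _.
rewrite rmorphM; apply: QM; case: gx => [[L [c [_ [_ rel] ->]]]|[t ->]].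
  exact: residue_map_relation_poly.
rewrite rmorphXn /= residue_map_var exprZn; apply: (idealZ square_ideal_ideal).
by apply: mem_ideal_gen; eexists.
Qed.

Lemma residue_map_edge_var p : 
  residue_map (edge_var K e p) = if e p.1 p.2 then residue p else 0.
Proof.
case: ifPn => [/(edge_exists he)[t [b ->]]|/(edge_var_nonedge K he) ->]; last exact: rmorph0.
rewrite edge_var_flip edge_var_edge linearZ /= residue_map_var residue_flip //.
by have := edge_lt t; apply: contraTneq => ->; rewrite ltnn.
Qed.

End Residues.

(** * The computation for the supergraphs of the pentagon *)

Definition pairs : seq (nat * nat) :=
  [:: (0,1); (0,2); (0,3); (0,4); (1,2); (1,3); (1,4); (2,3); (2,4); (3,4)]%N.

Definition signed_index (p : nat * nat) : nat * Z :=
  if (p.1 < p.2)%N then (index p pairs, Z.one)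
  else (index (p.2, p.1) pairs, Z.opp Z.one).

(** All cycles of the complete graph on 5 vertices, as lists of oriented edges. Starting at the
    smallest vertex and requiring the second vertex to be below the last one removes rotations and
    reversals. *)
Definition circuits : seq (seq (nat * nat)) :=
  [seq zip c (rot 1 c)
  | c <- undup [seq take m s | m <- iota 3 3, s <- permutations (iota 0 5)]
  & (head 5 c == foldr minn 5 c) && (nth 0 c 1 < last 0 c)]%N.

(** The check below succeeds with the functionals of these 24 orders alone. *)
Definition orders : seq (seq nat) := [seq 0%N :: s | s <- permutations (iota 1 4)].

(* Found by search: the corresponding linear form has maximal rank in every
   degree simultaneously for all 32 graphs containing the cycle 0-1-2-3-4-0. *)
Definition weight (i : nat) : Z := if i \in [:: 4; 8; 9]%N then Z.two else Z.one.

(** A circuit of size s gives a relation of degree s - 1, hence multipliers of degree k + 1 - s. *)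
Definition ideal_rows (g : seq nat) (k : nat) : seq zrow :=
  flatten [seq [seq sort_row (deriv_row [seq signed_index p | p <- c] m).2
               | m <- masks g (k.+1 - size c)]
          | c <- circuits
          & all (fun p => (signed_index p).1 \in g) c && (size c <= k.+1)%N].

Definition ell_row (g : seq nat) (m : N) : zrow :=
  sort_row (flatten [seq mul_row i (weight i) [:: (m, Z.one)] | i <- g]).

(** The argument [m] is a mask of edges, whereas the keys of the result are masks of vertices. *)
Definition residue_row (g o : seq nat) (m : N) : zrow :=
  foldr (fun i r =>
    if N.testbit m (N.of_nat i) then
      if i \in g then
        let p := nth (0, 0)%N pairs i in
        if (index p.2 o < index p.1 o)%N then mul_row p.1 Z.one r
        else mul_row p.2 (Z.opp Z.one) r
      else [::]
    else r) [:: (N0, Z.one)] (iota 0 10).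

Definition residue_ell_row (g o : seq nat) (m : N) : zrow :=
  flatten [seq scale_row x.2 (residue_row g o x.1) | x <- ell_row g m].

(** Only the low bits are compared because only they affect [mask_prod b]; this makes the test
    equivalent to equality of monomials. *)
Definition same_mask (b : nat) (m m' : N) : bool :=
  all (fun i => N.testbit m (N.of_nat i) == N.testbit m' (N.of_nat i)) (iota 0 b).

Definition row_coef (b : nat) (w : N) (r : zrow) : Z :=
  foldr (fun x z => if same_mask b x.1 w then Z.add x.2 z else z) Z0 r.

(** One linear equation per order and square-free monomial of degree k in the z_v. The unknowns are
    the coefficients of a combination of [B] whose product with the linear form lies in the
    ideal. *)
Definition functional_rows (g : seq nat) (B : seq N) (k : nat) : seq zrow :=
  flatten [seq let table := [seq (m, residue_ell_row g o m) | m <- B] in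
               [seq sort_row [seq x <- [seq (t.1, row_coef 5 w t.2) | t <- table]
                             | ~~ Z.eqb x.2 Z0]
               | w <- masks (iota 0 5) k]
          | o <- orders].

Definition heads (ps : seq zrow) : seq N :=
  pmap (fun r : zrow => if r is x :: _ then Some x.1 else None) ps.

(** Checking by computation that adding a free bit stays within the list replaces a proof that
    [masks] enumerates all subsets of the given size. *)
Definition masks_closed (g : seq nat) (k : nat) : bool :=
  all (fun m => all (fun i => N.testbit m (N.of_nat i) ||
                              (N.setbit m (N.of_nat i) \in masks g k.+1)) g) (masks g k).

Definition surjective_check (g : seq nat) (k : nat) : bool :=
  let known := solve [::] (echelon (ideal_rows g k.+1 ++ [seq ell_row g m | m <- masks g k])) in
  all (fun m => m \in known) (masks g k.+1).

(** The non-pivot monomials [B] span degree k modulo the circuit relations. The functionals then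
    force every combination of [B] killed by the linear form to have zero coefficients. *)
Definition injective_check (g : seq nat) (k : nat) : bool :=
  let ps := echelon (ideal_rows g k) in
  let hs := heads ps in
  let B := [seq m <- masks g k | m \notin hs] in
  let known := solve B ps in
  let zeros := solve [::] (echelon (functional_rows g B k.+1)) in
  [&& uniq B, all (fun m => m \in known) (masks g k) & all (fun m => m \in zeros) B].

Definition lefschetz_check (g : seq nat) : bool :=
  all (masks_closed g) (iota 0 4) &&
  all (injective_check g) (iota 0 3) && surjective_check g 3.

Definition pentagon_supergraphs : seq (seq nat) :=
  [seq [seq i <- iota 0 10 | (i \in [:: 0; 3; 4; 7; 9]%N) || (i \in mask bs [:: 1; 2; 5; 6; 8]%N)]
  | bs <- foldr (fun _ l => map (cons true) l ++ map (cons false) l) [:: [::]] (iota 0 5)].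

Lemma lefschetz_check_pentagon_supergraphs : all lefschetz_check pentagon_supergraphs.
Proof. by vm_compute. Qed.

Lemma circuits_ok : all (fun c : seq (nat * nat) => [&& c != [::],
    all (fun p => [&& p.1 < 5, p.2 < 5 & p.1 != p.2])%N c,
    uniq [seq (signed_index p).1 | p <- c] & perm_eq (unzip1 c) (unzip2 c)]) circuits.
Proof. by vm_compute. Qed.

Lemma orders_ok : all (fun o : seq nat => all (fun i => i \in o) (iota 0 5)) orders.
Proof. by vm_compute. Qed.

Lemma pairs_lt i : (i < 10)%N ->
  ((nth (0, 0) pairs i).1 < (nth (0, 0) pairs i).2)%N /\ ((nth (0, 0) pairs i).2 < 5)%N.
Proof. by do 10?[case: i => [//|i]]. Qed.

Lemma mem_pairs a b : (a < b)%N -> (b < 5)%N -> (a, b) \in pairs.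
Proof. by do 5?[case: a => [|a]] => //; do 5?[case: b => [|b]] => //. Qed.

Lemma signed_index_lt p : (p.1 < 5)%N -> (p.2 < 5)%N -> p.1 != p.2 ->
  ((signed_index p).1 < 10)%N.
Proof.
case: p => a b /=; by do 5?[case: a => [|a]] => //; do 5?[case: b => [|b]].
Qed.

Lemma signed_index_flip p : p.1 != p.2 ->
  (signed_index (flip_if true p)).1 = (signed_index p).1.
Proof. by case: p => a b; rewrite /signed_index /=; case: ltngtP. Qed.

(** * Soundness of the computation *)

Lemma homog_in_subspace (n : nat) (K : fieldType) (V : {mpoly K[n]} -> Prop) (k : nat) p :
  subspace V -> (forall m, mdeg m = k -> V 'X_[m]) -> p \is k.-homog -> V p.
Proof.
move=> hV VX /dhomogP hp; rewrite (mpolyE p); apply: (subspace_sum hV) => m mp _.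
by case: hV => _ _ VZ; apply/VZ/VX/hp.
Qed.

Lemma mdegS_split (n k : nat) (m : 'X_{1..n}) : mdeg m = k.+1 ->
  exists t m', mdeg m' = k /\ m = (U_(t) + m')%MM.
Proof.
move=> mk; have /existsP[t mt] : [exists t, m t != 0%N].
  apply: contra_eqT mk => /existsPn m0; rewrite mdegE big1 // => t _.
  by apply/eqP; rewrite -[_ == _]negbK.
have tm : (U_(t) <= m)%MM.
  by apply/mnm_lepP => s; rewrite mnm1E; case: eqP => // <-; rewrite lt0n.
exists t, (m - U_(t))%MM; split; last by rewrite addmC submK.
by have := congr1 mdeg (submK tm); rewrite mdegD mdeg1 mk addn1 => -[].
Qed.

(** A multiple of z_v^2 has only monomials with exponent at least 2 at v. Composed with a residue
    map, square-free coefficients thus become functionals vanishing on the AOT ideal. *)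
Lemma square_ideal_coef (n : nat) (K : fieldType) (p : {mpoly K[n]}) (m : 'X_{1..n}) :
  square_ideal p -> (forall v, (m v <= 1)%N) -> p@_m = 0.
Proof.
case=> s [sq ->] m1; rewrite raddf_sum big_seq big1 // => -[q r] /sq[v /= ->].
rewrite mpolyXn [q]mpolyE mulr_suml raddf_sum big1 // => k _ /=.
rewrite -scalerAl -mpolyXD mcoeffZ mcoeffX; case: eqP => [E|_]; last by rewrite mulr0.
have := m1 v; rewrite -E mnmDE mulmnE mnm1E eqxx; lia.
Qed.

Section PentagonCoordinates.
Variables (K : fieldType) (e : rel 'I_5) (Z : seq 'I_5).
Hypotheses (hK : [pchar K] =i pred0) (he : simple_graph e).
Hypotheses (Zu : uniq Z) (Z5 : size Z = 5%N).
Local Notation d := #|edges e|.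
Local Notation I := (AOT_ideal K e).
Local Notation "z %:K" := (scalar_of_Z K z) (at level 2, format "z %:K").

Let hI : ideal I := AOT_ideal_ideal K e.

(** Labelling vertices by their place in [Z] turns the cycle into 0-1-2-3-4-0. *)
Definition vertex (i : nat) : 'I_5 := nth ord0 Z i.
Definition vertex_pair (p : nat * nat) : 'I_5 * 'I_5 := (vertex p.1, vertex p.2).

Lemma mem_vertices v : v \in Z.
Proof.
have ZE : #|Z| = #|{: 'I_5}| by rewrite (card_uniqP Zu) Z5 card_ord.
by rewrite (subset_cardP ZE (subset_predT _)).
Qed.

Lemma vertex_index v : vertex (index v Z) = v.
Proof. by rewrite /vertex nth_index // mem_vertices. Qed.

Lemma index_vertex_lt v : (index v Z < 5)%N.
Proof. by have := mem_vertices v; rewrite -index_mem Z5. Qed.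

Lemma index_vertex i : (i < 5)%N -> index (vertex i) Z = i.
Proof. by move=> i5; rewrite index_uniq ?Z5. Qed.

Definition pair_index (p : 'I_5 * 'I_5) : nat * nat := (index p.1 Z, index p.2 Z).

Lemma vertex_pair_index p : vertex_pair (pair_index p) = p.
Proof. by case: p => u v; rewrite /vertex_pair /= !vertex_index. Qed.

Lemma pair_index_neq (p : 'I_5 * 'I_5) : p.1 != p.2 -> (pair_index p).1 != (pair_index p).2.
Proof.
by apply: contraNneq => /(congr1 vertex); rewrite !vertex_index => ->.
Qed.

(** Relabelling may reverse an edge, so this is a variable up to sign, or 0 when the pair is not an
    edge. *)
Definition pair_var (i : nat) : {mpoly K[d]} :=
  edge_var K e (vertex_pair (nth (0, 0)%N pairs i)).

Lemma pair_var_sqr i : I (pair_var i ^+ 2).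
Proof. exact: edge_var_sqr. Qed.

Lemma pair_var_homog i : pair_var i \is 1.-homog.
Proof. exact: edge_var_homog. Qed.

Lemma edge_var_signed_index p : (p.1 < 5)%N -> (p.2 < 5)%N -> p.1 != p.2 ->
  edge_var K e (vertex_pair p) = (signed_index p).2%:K *: pair_var (signed_index p).1.
Proof.
case: p => a b /= a5 b5 ab; rewrite /signed_index /= /pair_var.
case: ltngtP ab => [ab|ba|//] _; rewrite nth_index ?mem_pairs //=.
  by rewrite [Z.one%:K]rmorph1 scale1r.
rewrite (_ : vertex_pair (a, b) = flip_if true (vertex_pair (b, a))) //.
by rewrite edge_var_flip [(Z.opp Z.one)%:K]rmorphN1.
Qed.

Local Notation prod := (mask_prod 10 pair_var).
Local Notation val := (row_value prod).

Definition present : seq nat :=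
  [seq i <- iota 0 10 | e (vertex_pair (nth (0, 0) pairs i)).1
                          (vertex_pair (nth (0, 0) pairs i)).2]%N.

Lemma present_lt i : i \in present -> (i < 10)%N.
Proof. by rewrite mem_filter mem_iota => /andP[]. Qed.

Lemma signed_index_present p : (p.1 < 5)%N -> (p.2 < 5)%N -> p.1 != p.2 ->
  ((signed_index p).1 \in present) = e (vertex_pair p).1 (vertex_pair p).2.
Proof.
move=> p1 p2 p12; rewrite mem_filter mem_iota signed_index_lt // leq0n.
case: p p1 p2 p12 => a b /= a5 b5 ab; rewrite /signed_index /=.
case: ltngtP ab => [ab|ba|//] _; rewrite nth_index ?mem_pairs //= ?andbT //.
by case: he => ->.
Qed.

Lemma circuit_row_in c m : c \in circuits ->
  all (fun p => (signed_index p).1 \in present) c ->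
  I (val (sort_row (deriv_row [seq signed_index p | p <- c] m).2)).
Proof.
move=> /(allP circuits_ok)/and4P[c0 /allP cV cu cp] /allP ce; rewrite row_value_sort.
pose ps := [seq vertex_pair p | p <- c].
have esb : all (fun x => x.1 < 10)%N [seq signed_index p | p <- c].
  by apply/allP => _ /mapP[p pc ->]; have /and3P[*] := cV p pc; apply: signed_index_lt.
have [_] := row_value_deriv hI pair_var_sqr m esb.
move/(eqmod_in hI); apply; rewrite mulrC; case: (hI) => _ _; apply.
have -> : [seq x.2%:K *: pair_var x.1 | x <- [seq signed_index p | p <- c]] =
          [seq edge_var K e p | p <- ps].
  rewrite -!map_comp; apply/eq_in_map => p pc /=; have /and3P[*] := cV p pc.
  by rewrite edge_var_signed_index.
apply: circuit_deriv => //.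
- by rewrite -size_eq0 size_map size_eq0.
- apply/allP => _ /mapP[p pc ->]; have /and3P[*] := cV p pc.
  by rewrite -signed_index_present // ce.
(* The index of a pair ignores its orientation, so distinct indices give distinct ordered pairs. *)
- apply: (@map_uniq _ _ (fun p => (signed_index (pair_index p)).1)).
  rewrite -!map_comp; move: cu; apply: etrans; congr uniq; apply/eq_in_map => p pc /=.
  have /and3P[p1 p2 p12] := cV p pc.
  have pE : pair_index (vertex_pair p) = p.
    by case: (p) p1 p2 => a b *; rewrite /pair_index /= !index_vertex.
  rewrite /ordered_pair; case: (_ < _)%N => /=; last by rewrite pE.
  by rewrite -(signed_index_flip p12) /pair_index /= !index_vertex.
- have -> : unzip1 ps = map vertex (unzip1 c) by rewrite /unzip1 -!map_comp.
  have -> : unzip2 ps = map vertex (unzip2 c) by rewrite /unzip2 -!map_comp.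
  exact: perm_map.
Qed.

Lemma ideal_rows_in k (V : {mpoly K[d]} -> Prop) : (forall p, I p -> V p) ->
  rows_in prod V (ideal_rows present k).
Proof.
move=> IV; apply: rows_in_flatten => _ /mapP[c + ->].
rewrite mem_filter => /andP[/andP[ce _] cc].
by apply: rows_in_map => m _; apply/IV/circuit_row_in.
Qed.

Definition ell : {mpoly K[d]} := \sum_(i <- present) (weight i)%:K *: pair_var i.

Lemma ell_homog : ell \is 1.-homog.
Proof. by apply: rpred_sum => i _; apply/dhomogZ/pair_var_homog. Qed.

Lemma ell_row_value m : eqmod I (val (ell_row present m)) (ell * prod m).
Proof.
rewrite row_value_sort /ell mulr_suml.
have -> : val (flatten [seq mul_row i (weight i) [:: (m, Z.one)] | i <- present]) =
          \sum_(i <- present) val (mul_row i (weight i) [:: (m, Z.one)]).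
  by elim: present => [|i s IH]; rewrite ?big_nil ?row_value_nil // big_cons /= row_value_cat IH.
apply: (eqmod_sum hI) => i /present_lt i10.
have := row_value_mul hI pair_var_sqr (weight i) [:: (m, Z.one)] i10.
by rewrite row_value_cons row_value_nil addr0 [Z.one%:K]rmorph1 scale1r.
Qed.

(** Variables are multiplied in one at a time: a repeated one gives an element of the ideal, a new
    one sets a bit, and [masks_closed] keeps the mask in the list. *)
Lemma monomial_mask k (m : 'X_{1..d}) :
  (forall j, (j < k)%N -> masks_closed present j) -> mdeg m = k ->
  I 'X_[m] \/ exists w a, w \in masks present k /\ eqmod I 'X_[m] (a *: prod w).
Proof.
elim: k m => [|k IH] m cl mk.
  right; exists N0, 1; rewrite scale1r mask_prod0; split; first by case: present.
  by move/eqP: mk; rewrite mdeg_eq0 => /eqP ->; rewrite mpolyX0; apply: eqmod_refl.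
have [t [m' [m'k ->]]] := mdegS_split mk; rewrite mpolyXD.
have {}IH : I 'X_[m'] \/ exists w a, w \in masks present k /\ eqmod I 'X_[m'] (a *: prod w).
  by apply: IH => // j jk; apply: cl; apply: ltnW.
case: IH => [Im'|[w [a [wk wE]]]]; first by left; case: hI => _ _; apply.
have tneq : (edge t).1 != (edge t).2.
  by have := edge_lt t; apply: contraTneq => ->; rewrite ltnn.
set p := pair_index (edge t).
have tE : 'X_t = (signed_index p).2%:K *: pair_var (signed_index p).1.
  rewrite -edge_var_signed_index ?index_vertex_lt ?pair_index_neq //.
  by rewrite vertex_pair_index edge_var_edge.
have ig : (signed_index p).1 \in present.
  rewrite signed_index_present ?index_vertex_lt ?pair_index_neq //.
  by rewrite vertex_pair_index; apply: edge_rel.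
set i := (signed_index p).1 in tE ig; set b := (signed_index p).2 in tE.
have step : eqmod I ('X_t * 'X_[m']) ((b%:K * a) *: (pair_var i * prod w)).
  rewrite tE; apply: eqmod_trans (eqmodMl hI _ wE) _ => //.
  by rewrite -scalerAl -scalerAr scalerA; apply: eqmod_refl.
have [wi|wi] := boolP (N.testbit w (N.of_nat i)).
  left; apply: (eqmod_in hI step); apply: idealZ => //.
  by apply: mask_prod_testbit => //; [exact: pair_var_sqr | exact: present_lt].
right; exists (N.setbit w (N.of_nat i)), (b%:K * a).
split; last by rewrite mask_prod_setbit // present_lt.
by have /allP/(_ w wk)/allP/(_ i ig) := cl k (ltnSn k); rewrite (negbTE wi).
Qed.

Lemma homog_in_masks k (V : {mpoly K[d]} -> Prop) p :
  (forall j, (j < k)%N -> masks_closed present j) -> subspace V ->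
  (forall q, I q -> V q) -> {in masks present k, forall w, V (prod w)} ->
  p \is k.-homog -> V p.
Proof.
move=> cl hV IV Vprod; apply: homog_in_subspace => // m.
case/(monomial_mask cl) => [/IV //|[w [a [/Vprod Vw /IV Vd]]]].
case: hV => _ VD VZ; have := VD _ _ Vd (VZ a _ Vw).
by rewrite subrK.
Qed.

(** * Surjectivity of multiplication by the linear form *)

Definition image_mod (k : nat) (q : {mpoly K[d]}) : Prop :=
  exists2 a : {mpoly K[d]}, a \is k.-homog & I (ell * a - q).

Lemma image_mod_ideal k q : I q -> image_mod k q.
Proof.
move=> Iq; exists 0; first exact: dhomog0.
by rewrite mulr0 sub0r -scaleN1r; apply: idealZ.
Qed.

Lemma image_mod_subspace k : subspace (image_mod k).
Proof.
have [I0 ID IM] := hI; split; first exact: image_mod_ideal.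
  move=> q r [a ah aq] [a' a'h a'r]; exists (a + a'); first exact: dhomogD.
  by rewrite mulrDr opprD addrACA; apply: ID.
move=> c q [a ah aq]; exists (c *: a); first exact: dhomogZ.
by rewrite -scalerAr -scalerBr; apply: idealZ.
Qed.

Lemma surjective_check_sound k :
  (forall j, (j < k.+1)%N -> masks_closed present j) ->
  surjective_check present k -> mul_surjective I ell k.
Proof.
move=> cl /allP chk b bh; have hV := image_mod_subspace k; have IV := @image_mod_ideal k.
apply: (homog_in_masks cl hV IV) bh => w /chk; move: w.
apply: (solve_in hK hV) => //; apply: (echelon_in hK hV).
apply: rows_in_cat; first exact: ideal_rows_in.
apply: rows_in_map => m mk; exists (prod m); last first.
  exact: (eqmod_sym hI (ell_row_value m)).
apply: mask_prod_homog mk => //; last exact: pair_var_homog.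
by apply/allP => i /present_lt.
Qed.

(** The algebra is generated in degree 1: split a variable off a monomial and multiply a preimage of
    the rest by it. *)
Lemma mul_surjectiveS k : mul_surjective I ell k -> mul_surjective I ell k.+1.
Proof.
move=> sur b; apply: (homog_in_subspace (image_mod_subspace k.+1)).
move=> m /mdegS_split[t [m' [m'k ->]]].
have [|a ah aI] := sur 'X_[m']; first by rewrite dhomogX /= m'k.
exists ('X_t * a).
  by rewrite -[k.+1]add1n; apply: dhomogM => //; rewrite dhomogX /= mdeg1.
by rewrite mpolyXD mulrCA -mulrBr; case: hI => _ _; apply.
Qed.


(** * Residues in coordinates and injectivity *)

Definition position (o : seq nat) (v : 'I_5) : nat := index (index v Z) o.

Lemma position_inj o : o \in orders -> injective (position o).
Proof.
move=> /(allP orders_ok)/allP oI u v; rewrite /position => uv.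
have mem w : index w Z \in o by apply: oI; rewrite mem_iota index_vertex_lt.
rewrite -[u]vertex_index -[v]vertex_index; congr vertex.
by rewrite -(nth_index 0%N (mem u)) -(nth_index 0%N (mem v)) uv.
Qed.

Definition vertex_var (i : nat) : {mpoly K[5]} := 'X_(vertex i).

Local Notation zprod := (mask_prod 5 vertex_var).
Local Notation zval := (row_value zprod).
Local Notation Q := (@square_ideal K 5).

Let hQ : ideal Q := square_ideal_ideal K 5.

Lemma vertex_var_sqr i : Q (vertex_var i ^+ 2).
Proof. by apply: mem_ideal_gen; eexists. Qed.

Lemma residue_row_value o m : o \in orders ->
  eqmod Q (zval (residue_row present o m)) (residue_map (position o) (prod m)).
Proof.
move=> oo.
have -> : prod m = \prod_(i <- iota 0 10 | N.testbit m (N.of_nat i)) pair_var i.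
  by rewrite /mask_prod -(big_mkord (fun i => N.testbit m (N.of_nat i)) pair_var).
rewrite rmorph_prod /residue_row.
have : all (fun i => i < 10)%N (iota 0 10) by [].
elim: (iota 0 10) => [_|i s IH] /=.
  rewrite big_nil row_value_cons row_value_nil mask_prod0 addr0 [Z.one%:K]rmorph1 scale1r.
  exact: eqmod_refl.
case/andP=> i10 /IH{}IH; rewrite big_cons; case: ifP => // _.
have [lt12 lt5] := pairs_lt i10.
set p := nth _ _ i in lt12 lt5 *.
have -> : residue_map (position o) (pair_var i) =
    if i \in present then residue K (position o) (vertex_pair p) else 0.
  rewrite residue_map_edge_var //; last exact: position_inj.
  by rewrite mem_filter mem_iota leq0n i10 /= andbT.
case: ifP => _; last by rewrite mul0r row_value_nil; apply: eqmod_refl.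
rewrite /residue /later /later_sign /= /position !index_vertex ?(ltn_trans lt12) //.
have p15 : (p.1 < 5)%N by apply: ltn_trans lt5.
case: ifP => _.
  apply: eqmod_trans (row_value_mul hQ vertex_var_sqr _ _ p15) _ => //.
  by rewrite [Z.one%:K]rmorph1; apply: eqmodMl.
apply: eqmod_trans (row_value_mul hQ vertex_var_sqr _ _ lt5) _ => //.
by rewrite [(Z.opp Z.one)%:K]rmorphN1; apply: eqmodMl.
Qed.

Lemma residue_ell_row_value o m : o \in orders ->
  eqmod Q (zval (residue_ell_row present o m)) (residue_map (position o) (ell * prod m)).
Proof.
move=> oo; apply: (@eqmod_trans _ _ _ hQ (residue_map (position o) (val (ell_row present m)))).
  rewrite /residue_ell_row {2}/row_value rmorph_sum /=.
  elim: (ell_row present m) => [|x r IH]; rewrite ?big_nil ?row_value_nil; first exact: eqmod_refl.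
  rewrite big_cons /= row_value_cat; apply: eqmodD => //.
  by rewrite row_value_scale linearZ; apply: eqmodZ => //; apply: residue_row_value.
rewrite /eqmod -rmorphB; apply: (residue_map_ideal (position_inj oo)).
exact: ell_row_value.
Qed.

Definition mask_mnm (w : N) : 'X_{1..5} :=
  (\sum_(i < 5 | N.testbit w (N.of_nat i)) U_(vertex i))%MM.

Lemma zprodE w : zprod w = 'X_[mask_mnm w].
Proof. exact: mprodXE. Qed.

Lemma mask_mnm_vertex w i : (i < 5)%N -> mask_mnm w (vertex i) = N.testbit w (N.of_nat i).
Proof.
move=> i5; rewrite mnm_sumE big_mkcond (bigD1 (Ordinal i5)) //= big1 => [|j ji].
  by rewrite mnm1E eqxx addn0; case: ifP.
case: ifP => //= _; rewrite mnm1E; have [E|//] := eqVneq (vertex j) (vertex i).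
by move: ji; rewrite -val_eqE /= -(index_vertex (ltn_ord j)) -(index_vertex i5) E eqxx.
Qed.

Lemma mask_mnm_eq w w' : (mask_mnm w == mask_mnm w') = same_mask 5 w w'.
Proof.
apply/eqP/allP => [E i|E].
  rewrite mem_iota => i5; apply/eqP.
  have := congr1 (fun m : 'X_{1..5} => m (vertex i)) E.
  by rewrite !mask_mnm_vertex //; do 2!case: N.testbit.
apply/mnmP => v; rewrite -[v]vertex_index !mask_mnm_vertex ?index_vertex_lt //.
by congr nat_of_bool; apply/eqP/E; rewrite mem_iota index_vertex_lt.
Qed.

Lemma row_coefE w r : (zval r)@_(mask_mnm w) = (row_coef 5 w r)%:K.
Proof.
elim: r => [|[m c] r IH]; first by rewrite row_value_nil mcoeff0 [RHS]rmorph0.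
rewrite row_value_cons mcoeffD IH mcoeffZ zprodE mcoeffX mask_mnm_eq /=.
by case: ifP => _; rewrite ?mulr1 ?scalar_of_ZD // mulr0 add0r.
Qed.

(** The residue of an element of the AOT ideal has no square-free coefficients. Here the
    coefficients [c] play the part of the vectors attached to keys, and the subspace is 0. *)
Lemma functional_rows_in (B : seq N) (c : N -> K) k :
  I (ell * \sum_(m <- B) c m *: prod m) ->
  rows_in (c : N -> K^o) (fun x => x = 0) (functional_rows present B k).
Proof.
move=> Ic; apply: rows_in_flatten => _ /mapP[o oo ->]; apply: rows_in_map => w _.
rewrite row_value_sort /row_value big_filter big_map big_map /=.
have /(square_ideal_coef (m := mask_mnm w)) :
    Q (\sum_(m <- B) c m *: zval (residue_ell_row present o m)).
  have := residue_map_ideal (position_inj oo) Ic.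
  apply: (eqmod_in hQ); rewrite mulr_sumr rmorph_sum; apply: (eqmod_sum hQ) => m _.
  rewrite /= -scalerAr linearZ /=; apply: eqmodZ => //; exact: residue_ell_row_value.
move=> H; rewrite -[RHS]H; last first.
  by move=> v; rewrite -[v]vertex_index mask_mnm_vertex ?index_vertex_lt // leq_b1.
rewrite raddf_sum big_mkcond /=; apply: eq_bigr => m _.
rewrite mcoeffZ row_coefE; case: Z.eqb_spec => [->|_] /=; last exact: mulrC.
by rewrite [Z0%:K]rmorph0 mulr0.
Qed.

Lemma injective_check_sound k :
  (forall j, (j < k)%N -> masks_closed present j) ->
  injective_check present k -> mul_injective I ell k.
Proof.
move=> cl; rewrite /injective_check.
set ps := echelon _; set B := filter _ _; case/and3P=> Bu /allP spanB /allP freeB a b ah bh Iab.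
(* The first elimination takes place in the span of [B] modulo the ideal and expresses [a - b]
   there; the second takes place in [K] and kills the coefficients. *)
pose V q := exists c : N -> K, eqmod I q (\sum_(m <- B) c m *: prod m).
have IV q : I q -> V q.
  by move=> Iq; exists (fun=> 0); rewrite big1 => [|m _]; rewrite ?scale0r // /eqmod subr0.
have hV : subspace V.
  split; first by apply: IV; case: hI.
    move=> q r [c qc] [c' rc]; exists (fun m => c m + c' m).
    under eq_bigr do rewrite scalerDl.
    by rewrite big_split; apply: eqmodD.
  move=> z q [c qc]; exists (fun m => z * c m).
  under eq_bigr do rewrite -scalerA.
  by rewrite -scaler_sumr; apply: eqmodZ.
have BV : {in B, forall m, V (prod m)}.
  move=> m mB; exists (fun m' => (m' == m)%:R).
  rewrite (bigD1_seq m) //= eqxx scale1r big1 => [|m' /negbTE ->]; last exact: scale0r.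
  by rewrite addr0; apply: eqmod_refl.
have [c abc] : V (a - b).
  apply: (homog_in_masks cl hV IV); last by rewrite rpredB.
  move=> w /spanB; move: w; apply: (solve_in hK hV) => //; apply: (echelon_in hK hV).
  exact: ideal_rows_in.
have Ic : I (ell * \sum_(m <- B) c m *: prod m).
  by apply: (eqmod_in hI) (eqmodMl hI ell (eqmod_sym hI abc)) _; rewrite mulrBr.
have h0 : subspace (fun x : K^o => x = 0).
  by split=> [//|x y -> ->|z x ->]; rewrite ?addr0 ?scaler0.
have c0 m : m \in B -> c m = 0.
  move=> /freeB; move: m; apply: (solve_in hK h0) => //; apply: (echelon_in hK h0).
  exact: functional_rows_in.
apply: (eqmod_in hI abc); rewrite big_seq big1 => [|m /c0 ->]; last exact: scale0r.
by case: hI.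
Qed.

Lemma lefschetz_check_sound : lefschetz_check present -> has_WLP I.
Proof.
case/andP=> /andP[/allP cl /allP inj] sur; exists ell; first exact: ell_homog.
move=> i; have clE j : (j < 4)%N -> masks_closed present j by move=> ?; apply: cl; rewrite mem_iota.
have [i3|i3] := ltnP i 3; [left|right].
  apply: injective_check_sound; last by apply: inj; rewrite mem_iota.
  by move=> j ji; apply: clE; lia.
rewrite -(subnK i3) addnC; elim: (i - 3)%N => [|j IH].
  exact: surjective_check_sound.
by rewrite addnS; apply: mul_surjectiveS.
Qed.

End PentagonCoordinates.

(** * Graphs containing a five-cycle *)

Lemma filter_pentagon_supergraphs (P : pred nat) :
  {in [:: 0; 3; 4; 7; 9]%N, forall i, P i} ->
  [seq i <- iota 0 10 | P i] \in pentagon_supergraphs.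
Proof.
(* In [pairs], the indices 0, 3, 4, 7, 9 are the sides of the pentagon and 1, 2, 5, 6, 8 its
   chords. *)
move=> Pc; apply/mapP; exists [:: P 1; P 2; P 5; P 6; P 8]%N.
  by case: (P 1%N) (P 2%N) (P 5%N) (P 6%N) (P 8%N) => [] [] [] [] [].
have [P0 P3 P4 P7 P9] : [/\ P 0, P 3, P 4, P 7 & P 9]%N by split; apply: Pc.
apply: eq_in_filter => i; rewrite mem_iota => /andP[_].
do 10?[case: i => [|i]] => // _; rewrite ?P0 ?P3 ?P4 ?P7 ?P9 //.
all: by case: (P 1%N) (P 2%N) (P 5%N) (P 6%N) (P 8%N) => [] [] [] [] [].
Qed.

Lemma pentagon_supergraph_has_WLP (K : fieldType) (e : rel 'I_5) (Z : seq 'I_5) :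
  [pchar K] =i pred0 -> simple_graph e -> ucycle e Z -> size Z = 5%N ->
  graph_has_WLP K e.
Proof.
move=> hK he /andP[cyc Zu] Z5; apply: (lefschetz_check_sound hK he Zu Z5).
apply: (allP lefschetz_check_pentagon_supergraphs).
apply: filter_pentagon_supergraphs => i ic.
case: he => esym _; case: Z Z5 cyc {Zu} => [|a [|b [|c [|w [|x []]]]]] //= _.
rewrite andbT => /and5P[ab bc cw wx xa].
(* Symmetry is needed for the closing side, which the cycle traverses from 4 to 0 but [pairs] lists
   as (0,4). *)
by move: ic; rewrite !inE; do 4?[case/orP]; move=> /eqP ->; rewrite /vertex_pair //= esym.
Qed.

Theorem theorem3p9 (K : fieldType) (hK : [pchar K] =i pred0)
    (G : rel 'I_5) (hG : simple_graph G)
    (Z : seq 'I_5) (hZ : ucycle G Z) (hZ5 : size Z = 5%N)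
    (ord : rel 'X_{1..#|edges G|}) (hord : monomial_order ord)
    (hJ : has_WLP (initial_ideal ord (AOT_ideal K G)))
    (u v : 'I_5) (huv : is_chord Z u v) (hnew : ~~ G u v) :
  graph_has_WLP K (add_edge G u v).
Proof.
have [cyc Zu] := andP hZ; have /and5P[_ _ uv _ _] := huv.
(* The enlarged graph still contains the cycle [Z], and it stays simple because the chord joins
   distinct vertices. *)
apply: (pentagon_supergraph_has_WLP hK) hZ5; last first.
  by rewrite /ucycle Zu andbT; apply: sub_cycle cyc => x y; rewrite /add_edge => ->.
case: hG => Gsym Girr; split=> [x y|x].
  by rewrite /add_edge Gsym; congr (_ || _); rewrite orbC andbC [X in _ || X]andbC.
rewrite /add_edge Girr /=; apply/negbTE; rewrite negb_or !negb_and.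
by have [->|] := eqVneq x u; rewrite ?uv //= orbT.
Qed.
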